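(* Let $d\ge1$ and $n\ge3$ be integers. Then ${\rm YTL}_{d,n}(u)$ is the $K$-algebra generated by $1,t_1,\dots,t_n,g_1,\dots,g_{n-1}$ subject to the defining relations of ${\rm Y}_{d,n}(u)$ together with the single relation $g_{1,2}=0$.
   Context: Let $u$ be an indeterminate and $K=\mathbb{C}(u)$; algebras are associative unital $K$-algebras. The Yokonuma--Hecke algebra ${\rm Y}_{d,n}(u)$ is the $K$-algebra generated by $g_1,\dots,g_{n-1},t_1,\dots,t_n$ subject to the defining relations: $g_ig_j=g_jg_i$ for $|i-j|>1$; $g_{i+1}g_ig_{i+1}=g_ig_{i+1}g_i$; $g_i^2=1+(u-1)e_i+(u-1)e_ig_i$; $t_it_j=t_jt_i$ for all $i,j$; $t_i^d=1$; $g_it_i=t_{i+1}g_i$; $g_it_{i+1}=t_ig_i$; $g_it_j=t_jg_i$ for $j\ne i,i+1$; where $e_i:=\frac1d\sum_{s=0}^{d-1}t_i^st_{i+1}^{-s}$. For $|i-j|=1$ put $g_{i,j}:=1+g_i+g_j+g_ig_j+g_jg_i+g_ig_jg_i$. For $n\ge3$, the Yokonuma--Temperley--Lieb algebra is ${\rm YTL}_{d,n}(u):={\rm Y}_{d,n}(u)/I$, where $I$ is the two-sided ideal generated by all $g_{i,j}$ with $|i-j|=1$. (So the claim amounts to saying that $I$ is generated, as a two-sided ideal, by $g_{1,2}$ alone.) *)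

(* Defs.v *)
From HB Require Import structures.
From mathcomp Require Import all_boot all_algebra ring.
From mathcomp Require Import boolp classical_sets reals complex.
From mathcomp.multinomials Require Import monalg.

Set Implicit Arguments.
Unset Strict Implicit.
Unset Printing Implicit Defensive.

Import GRing.Theory.

Local Open Scope ring_scope.
Local Open Scope quotient_scope.
Local Open Scope classical_set_scope.

Section Ideal.
Variables (K : comNzRingType) (A : algType K).

(* Stability under [*:] is automatic in a unital algebra. *)
Definition two_sided_ideal (I : set A) : Prop :=
  [/\ I 0, forall x y, I x -> I y -> I (x - y),
      forall a x, I x -> I (a * x) & forall a x, I x -> I (x * a)].

Definition ideal_gen (S : set A) : set A := smallest two_sided_ideal S.

Lemma ideal_genP S : two_sided_ideal (ideal_gen S).
Proof.
split=> [I [[]]//|x y Ix Iy I I_S|a x Ix I I_S|a x Ix I I_S];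
  case: (I_S) => -[I0 IB Il Ir] _.
- by apply: IB; [apply: Ix | apply: Iy].
- by apply: Il; apply: Ix.
- by apply: Ir; apply: Ix.
Qed.

Definition ideal_pred (S : set A) : {pred A} := fun x => `[< ideal_gen S x >].

Lemma in_ideal_pred S x : (x \in ideal_pred S) = `[< ideal_gen S x >].
Proof. by []. Qed.

Lemma ideal_pred_zmod S : zmod_closed (ideal_pred S).
Proof.
have [I0 IB _ _] := ideal_genP S.
by split=> [|x y /asboolP Ix /asboolP Iy]; apply/asboolP => //; apply: IB.
Qed.

End Ideal.

HB.instance Definition _ (K : comNzRingType) (A : algType K) (S : set A) :=
  GRing.isZmodClosed.Build A (ideal_pred S) (ideal_pred_zmod S).

(* An [algType] is nontrivial, so only the quotients by proper ideals are
   algebras in this sense. *)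
HB.mixin Record isProper (K : comNzRingType) (A : algType K) (S : set A) := {
  proper_subproof : ~ ideal_gen S 1
}.

#[short(type="properSet")]
HB.structure Definition Proper (K : comNzRingType) (A : algType K) :=
  {S of isProper K A S}.

Section Proper.
Variables (K : comNzRingType) (A : algType K) (B : nzRingType) (f : A -> B).
Hypotheses (fB : zmod_morphism f) (fM : monoid_morphism f).

Lemma proper_of_morphism (S : set A) :
  (forall x, S x -> f x = 0) -> ~ ideal_gen S 1.
Proof.
move=> fS /(_ [set x | f x = 0]) /= f1.
have f0 : f 0 = 0 by rewrite -(subrr 0) fB subrr.
have /eqP : f 1 = 0.
  apply: f1; split=> //; split=> //=.
  - by move=> x y fx fy; rewrite fB fx fy subrr.
  - by move=> a x fx; rewrite fM.2 fx mulr0.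
  - by move=> a x fx; rewrite fM.2 fx mul0r.
by rewrite fM.1 oner_eq0.
Qed.

End Proper.

Definition alg_quot (K : comNzRingType) (A : algType K) (S : set A) : Type :=
  Quotient.quot (ideal_pred S).

HB.instance Definition _ (K : comNzRingType) (A : algType K) (S : set A) :=
  GRing.Zmodule.on (alg_quot S).

Definition alg_pi (K : comNzRingType) (A : algType K) (S : set A) (x : A) :
  alg_quot S := \pi_(Quotient.quot (ideal_pred S)) x.
Definition alg_repr (K : comNzRingType) (A : algType K) (S : set A)
  (x : alg_quot S) : A := repr (x : Quotient.quot (ideal_pred S)).

(* Locking keeps conversion from unfolding the operations. *)
HB.lock Definition alg_one (K : comNzRingType) (A : algType K) (S : set A) :
  alg_quot S := alg_pi S 1.
HB.lock Definition alg_mul (K : comNzRingType) (A : algType K) (S : set A)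
  (x y : alg_quot S) : alg_quot S := alg_pi S (alg_repr x * alg_repr y).
HB.lock Definition alg_scale (K : comNzRingType) (A : algType K) (S : set A)
  (k : K) (x : alg_quot S) : alg_quot S := alg_pi S (k *: alg_repr x).

Section AlgQuotient.
Variables (K : comNzRingType) (A : algType K).

Section Any.
Variable S : set A.
Local Notation Q := (alg_quot S).
Local Notation pi := (@alg_pi K A S).
Local Notation rp := (@alg_repr K A S).

Lemma alg_reprK (x : Q) : pi (rp x) = x.
Proof. exact: reprK. Qed.

Lemma alg_piP (x y : A) : pi x = pi y <-> ideal_gen S (x - y).
Proof.
rewrite -[ideal_gen S _]asboolE -in_ideal_pred Quotient.idealrBE.
by split=> [/eqP|/eqP].
Qed.

Lemma alg_pi_sub : zmod_morphism pi.
Proof. by move=> x y; rewrite /alg_pi raddfB. Qed.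

Local Notation alg_one := (@alg_one K A S).
Local Notation alg_mul := (@alg_mul K A S).
Local Notation alg_scale := (@alg_scale K A S).

Lemma alg_piM x y : pi (x * y) = alg_mul (pi x) (pi y).
Proof.
rewrite alg_mul.unlock.
have [_ IB Il Ir] := ideal_genP S.
have h z : ideal_gen S (z - rp (pi z)) by apply/alg_piP; rewrite alg_reprK.
have ID a b : ideal_gen S a -> ideal_gen S b -> ideal_gen S (a + b).
  have I0 : ideal_gen S 0 by case: (ideal_genP S).
  by move=> Ia Ib; rewrite -[b]opprK; apply: (IB) => //; rewrite -sub0r; apply: IB.
apply/alg_piP; rewrite -[_ * _](addrNK (x * rp (pi y))) -mulrBr -addrA -mulrBl.
by apply: ID; [apply: Il | apply: Ir].
Qed.

Lemma alg_piZ k x : pi (k *: x) = alg_scale k (pi x).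
Proof.
rewrite alg_scale.unlock.
have [_ IB Il Ir] := ideal_genP S.
apply/alg_piP; rewrite -scalerBr -[_ - _]mul1r scalerAl; apply: Il.
by apply/alg_piP; rewrite alg_reprK.
Qed.

Lemma alg_piD x y : pi (x + y) = pi x + pi y.
Proof. by rewrite /alg_pi raddfD. Qed.

Lemma alg_pi1 : pi 1 = alg_one. Proof. by rewrite alg_one.unlock. Qed.

Lemma alg_mulA : associative alg_mul.
Proof.
by move=> x y z; rewrite -[x]alg_reprK -[y]alg_reprK -[z]alg_reprK -!alg_piM mulrA.
Qed.
Lemma alg_mul1 : left_id alg_one alg_mul.
Proof. by move=> x; rewrite -[x]alg_reprK -alg_pi1 -alg_piM mul1r. Qed.
Lemma alg_mulr1 : right_id alg_one alg_mul.
Proof. by move=> x; rewrite -[x]alg_reprK -alg_pi1 -alg_piM mulr1. Qed.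
Lemma alg_mulDl : left_distributive alg_mul +%R.
Proof.
move=> x y z; rewrite -[x]alg_reprK -[y]alg_reprK -[z]alg_reprK.
by rewrite -alg_piD -!alg_piM -alg_piD mulrDl.
Qed.
Lemma alg_mulDr : right_distributive alg_mul +%R.
Proof.
move=> x y z; rewrite -[x]alg_reprK -[y]alg_reprK -[z]alg_reprK.
by rewrite -alg_piD -!alg_piM -alg_piD mulrDr.
Qed.

HB.instance Definition _ := GRing.Zmodule_isPzRing.Build Q
  alg_mulA alg_mul1 alg_mulr1 alg_mulDl alg_mulDr.

Lemma alg_scaleA a b v : alg_scale a (alg_scale b v) = alg_scale (a * b) v.
Proof. by rewrite -[v]alg_reprK -!alg_piZ scalerA. Qed.
Lemma alg_scale1 : left_id 1 alg_scale.
Proof. by move=> v; rewrite -[v]alg_reprK -alg_piZ scale1r. Qed.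
Lemma alg_scaleDr : right_distributive alg_scale +%R.
Proof.
by move=> k v w; rewrite -[v]alg_reprK -[w]alg_reprK -alg_piD -!alg_piZ -alg_piD scalerDr.
Qed.
Lemma alg_scaleDl v : {morph alg_scale^~ v : a b / a + b}.
Proof. by move=> a b; rewrite -[v]alg_reprK -!alg_piZ -alg_piD scalerDl. Qed.

HB.instance Definition _ := GRing.Zmodule_isLmodule.Build K Q
  alg_scaleA alg_scale1 alg_scaleDr alg_scaleDl.

End Any.

Variable S : properSet A.
Local Notation Q := (alg_quot S).

Lemma alg_oner_neq0 : (1 : Q) != 0.
Proof.
apply/eqP => /= h; apply: (@proper_subproof _ _ S).
rewrite -[1 in X in _ X]subr0; apply/alg_piP; rewrite alg_pi1; apply: (etrans h).
by rewrite /alg_pi raddf0.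
Qed.

HB.instance Definition _ := GRing.PzSemiRing_isNonZero.Build Q alg_oner_neq0.

Lemma alg_scaleAl k (x y : Q) : k *: (x * y) = (k *: x) * y.
Proof.
rewrite -[x]alg_reprK -[y]alg_reprK -[LHS]/(@alg_scale _ _ S _ (alg_mul _ _)).
by rewrite -[RHS]/(@alg_mul _ _ S (alg_scale _ _) _) -alg_piM -!alg_piZ -alg_piM scalerAl.
Qed.
Lemma alg_scaleAr k (x y : Q) : k *: (x * y) = x * (k *: y).
Proof.
rewrite -[x]alg_reprK -[y]alg_reprK -[LHS]/(@alg_scale _ _ S _ (alg_mul _ _)).
by rewrite -[RHS]/(@alg_mul _ _ S _ (alg_scale _ _)) -alg_piM -!alg_piZ -alg_piM scalerAr.
Qed.

HB.instance Definition _ := GRing.Lmodule_isLalgebra.Build K Q alg_scaleAl.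
HB.instance Definition _ := GRing.Lalgebra_isAlgebra.Build K Q alg_scaleAr.

HB.instance Definition _ :=
  GRing.isZmodMorphism.Build A Q (@alg_pi K A S) (@alg_pi_sub S).
HB.instance Definition _ :=
  GRing.isMonoidMorphism.Build A Q (@alg_pi K A S) (conj (@alg_pi1 S) (@alg_piM S)).
HB.instance Definition _ :=
  GRing.isScalable.Build K A Q *:%R (@alg_pi K A S) (@alg_piZ S).

End AlgQuotient.

Section Lift.
Variables (K : comNzRingType) (A : algType K) (B : algType K).
Variables (f : {lrmorphism A -> B}) (S : properSet A).
Hypothesis fS : forall x, (S : set A) x -> f x = 0.

Definition alg_lift (x : alg_quot S) : B := f (alg_repr x).

Lemma alg_lift_pi x : alg_lift (alg_pi S x) = f x.
Proof.
apply/eqP; rewrite -subr_eq0 -raddfB; apply/eqP.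
suff /(_ (alg_repr (alg_pi S x) - x)) : ideal_gen S `<=` [set z | f z = 0].
  by apply; apply/alg_piP; rewrite alg_reprK.
apply: smallest_sub => //; split=> [|y z|a y|a y] /=.
- exact: raddf0.
- by move=> fy fz; rewrite raddfB /= fy fz subrr.
- by move=> fy; rewrite rmorphM /= fy mulr0.
- by move=> fy; rewrite rmorphM /= fy mul0r.
Qed.

Lemma alg_liftB : zmod_morphism alg_lift.
Proof.
move=> x y; rewrite -[x]alg_reprK -[y]alg_reprK -raddfB !alg_lift_pi.
exact: raddfB.
Qed.

Lemma alg_liftM : monoid_morphism alg_lift.
Proof.
split=> [|x y]; first by rewrite -(rmorph1 (@alg_pi _ _ S)) alg_lift_pi rmorph1.
rewrite -[x]alg_reprK -[y]alg_reprK -rmorphM !alg_lift_pi; exact: rmorphM.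
Qed.

End Lift.

Definition free_alg (K : comNzRingType) (I : choiceType) : Type :=
  {malg K[{fmonom I}]}.

HB.instance Definition _ (K : comNzRingType) (I : choiceType) :=
  GRing.Zmodule.on (free_alg K I).

HB.lock Definition free_one (K : comNzRingType) (I : choiceType) :
  free_alg K I := (1 : {malg K[{fmonom I}]}).
HB.lock Definition free_mul (K : comNzRingType) (I : choiceType)
  (x y : free_alg K I) : free_alg K I := (x * y : {malg K[{fmonom I}]}).
HB.lock Definition free_scale (K : comNzRingType) (I : choiceType)
  (k : K) (x : free_alg K I) : free_alg K I := (k *: x : {malg K[{fmonom I}]}).
HB.lock Definition free_gen (K : comNzRingType) (I : choiceType) (i : I) :
  free_alg K I := mkmalgU (fmu i) 1.

Fact commr_mulA (R : nzRingType) (a b c : R) :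
  a * b = b * a -> a * (b * c) = b * (a * c).
Proof. by move=> ab; rewrite !mulrA ab. Qed.

Fact malg_scaleAr (K : comNzRingType) (M : monomType) (k : K)
  (x y : {malg K[M]}) : k *: (x * y) = x * (k *: y).
Proof.
have cC : k%:MP * x = x * k%:MP.
  rewrite !malgM_def fgmulUg fgmulgU; apply: eq_bigr => m _.
  by rewrite mulrC mul1m mulm1.
exact: (etrans (esym (mul_malgC k (x * y)))
  (etrans (commr_mulA y cC) (congr1 (GRing.mul x) (mul_malgC k y)))).
Qed.

Section FreeAlgebra.
Variables (K : comNzRingType) (I : choiceType).
Local Notation F := (free_alg K I).
Local Notation mul := (@free_mul K I).
Local Notation one := (free_one K I).
Local Notation scale := (@free_scale K I).

Let mulE : mul = fun x y => (x * y : {malg K[{fmonom I}]}).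
Proof. by rewrite free_mul.unlock. Qed.
Let oneE : one = (1 : {malg K[{fmonom I}]}).
Proof. by rewrite free_one.unlock. Qed.
Let scaleE : scale = fun k x => (k *: x : {malg K[{fmonom I}]}).
Proof. by rewrite free_scale.unlock. Qed.

Lemma free_mulA : associative mul.
Proof. rewrite mulE; exact: mulrA. Qed.
Lemma free_mul1 : left_id one mul.
Proof. rewrite mulE oneE; exact: mul1r. Qed.
Lemma free_mulr1 : right_id one mul.
Proof. rewrite mulE oneE; exact: mulr1. Qed.
Lemma free_mulDl : left_distributive mul +%R.
Proof. rewrite mulE; exact: mulrDl. Qed.
Lemma free_mulDr : right_distributive mul +%R.
Proof. rewrite mulE; exact: mulrDr. Qed.
Lemma free_one_neq0 : one != 0.
Proof. rewrite oneE; exact: oner_neq0. Qed.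

HB.instance Definition _ := GRing.Zmodule_isNzRing.Build F
  free_mulA free_mul1 free_mulr1 free_mulDl free_mulDr free_one_neq0.

Lemma free_scaleA a b v : scale a (scale b v) = scale (a * b) v.
Proof. rewrite scaleE; exact: scalerA. Qed.
Lemma free_scale1 : left_id 1 scale.
Proof. rewrite scaleE; exact: scale1r. Qed.
Lemma free_scaleDr : right_distributive scale +%R.
Proof. rewrite scaleE; exact: scalerDr. Qed.
Lemma free_scaleDl v : {morph scale^~ v : a b / a + b}.
Proof. rewrite scaleE; exact: scalerDl. Qed.

HB.instance Definition _ := GRing.Zmodule_isLmodule.Build K F
  free_scaleA free_scale1 free_scaleDr free_scaleDl.

Lemma free_scaleAl k (x y : F) : k *: (x * y) = (k *: x) * y.
Proof.
by rewrite -[LHS]/(scale k (mul x y)) -[RHS]/(mul (scale k x) y) mulE scaleE scalerAl.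
Qed.

Lemma free_scaleAr k (x y : F) : k *: (x * y) = x * (k *: y).
Proof.
rewrite -[LHS]/(scale k (mul x y)) -[RHS]/(mul x (scale k y)) mulE scaleE.
exact: malg_scaleAr.
Qed.

HB.instance Definition _ := GRing.Lmodule_isLalgebra.Build K F free_scaleAl.
HB.instance Definition _ := GRing.Lalgebra_isAlgebra.Build K F free_scaleAr.

Section Eval.
Variables (B : algType K) (f : I -> B).

Definition free_eval_mon (m : {fmonom I}) : B := \prod_(i <- (m : seq I)) f i.

Lemma free_eval_mon_morph : mmorphism free_eval_mon.
Proof.
by split=> [x y|]; rewrite /free_eval_mon ?fmM ?big_cat // fm1 big_nil.
Qed.

HB.instance Definition _ :=
  isMultiplicative.Build {fmonom I} B free_eval_mon free_eval_mon_morph.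

Definition free_eval : F -> B := mmap (in_alg B) free_eval_mon.

Lemma free_evalB : zmod_morphism free_eval.
Proof. exact: mmap_is_additive. Qed.

Lemma free_evalM : monoid_morphism free_eval.
Proof.
have [|m1 mM] := @commr_mmap_is_multiplicative _ K B (in_alg B) free_eval_mon.
  by move=> g m m'; rewrite /GRing.comm /= -scalerAl -scalerAr mul1r mulr1.
split=> [|x y].
- by rewrite -[1]/one oneE.
- by rewrite -[x * y]/(mul x y) mulE; apply: m1.
Qed.

Lemma free_evalZ : scalable free_eval.
Proof.
move=> k x; rewrite -[k *: x]/(scale k x) scaleE.
by rewrite /free_eval mmapZ -scalerAl mul1r.
Qed.

HB.instance Definition _ := GRing.isZmodMorphism.Build F B free_eval free_evalB.
HB.instance Definition _ := GRing.isMonoidMorphism.Build F B free_eval free_evalM.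
HB.instance Definition _ := GRing.isScalable.Build K F B *:%R free_eval free_evalZ.

Lemma free_eval_gen i : free_eval (free_gen K i) = f i.
Proof.
by rewrite free_gen.unlock /free_eval mmapU /free_eval_mon fmU big_seq1 /= scale1r mul1r.
Qed.

End Eval.
End FreeAlgebra.

(* The relators [lhs - rhs] of a set [R] of relations [lhs = rhs]. *)
Definition relators (A : zmodType) (R : A -> A -> Prop) : set A :=
  [set z | exists x y, R x y /\ z = x - y].

Section YokonumaHecke.
Variables (K : fieldType) (u : K) (d n : nat).

(* [inl i] is the generator g_(i+1) and [inr j] is the generator t_(j+1). *)
Definition yh_gen : choiceType := ('I_n.-1 + 'I_n)%type.

Lemma ord_lo_subproof (i : 'I_n.-1) : (i < n)%N.
Proof. by apply: leq_trans (ltn_ord i) (leq_pred n). Qed.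
Lemma ord_hi_subproof (i : 'I_n.-1) : (i.+1 < n)%N.
Proof. by rewrite -ltn_predRL ltn_ord. Qed.

(* For g_i, these are the positions of t_i and t_(i+1). *)
Definition ord_lo (i : 'I_n.-1) : 'I_n := Ordinal (ord_lo_subproof i).
Definition ord_hi (i : 'I_n.-1) : 'I_n := Ordinal (ord_hi_subproof i).

Section Elements.
Variable A : algType K.

(* As t^d = 1 is imposed, t^(-s) is written t^(d - s) for s <= d. *)
Definition e_elt (t : 'I_n -> A) (i : 'I_n.-1) : A :=
  d%:R^-1 *: \sum_(s < d) t (ord_lo i) ^+ s * t (ord_hi i) ^+ (d - s).

Definition gg_elt (g : 'I_n.-1 -> A) (i j : 'I_n.-1) : A :=
  1 + g i + g j + g i * g j + g j * g i + g i * g j * g i.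

End Elements.

Local Notation F := (free_alg K yh_gen).

Definition free_g (i : 'I_n.-1) : F := free_gen K (inl i : yh_gen).
Definition free_t (j : 'I_n) : F := free_gen K (inr j : yh_gen).

Local Notation g := free_g.
Local Notation t := free_t.
Local Notation e := (e_elt t).

Inductive yh_rel : F -> F -> Prop :=
| YH_gg_far (i j : 'I_n.-1) of (`|i - j| > 1)%N : yh_rel (g i * g j) (g j * g i)
| YH_braid (i j : 'I_n.-1) of j = i.+1 :> nat :
    yh_rel (g j * g i * g j) (g i * g j * g i)
| YH_quad (i : 'I_n.-1) :
    yh_rel (g i ^+ 2) (1 + (u - 1) *: e i + (u - 1) *: (e i * g i))
| YH_tt (i j : 'I_n) : yh_rel (t i * t j) (t j * t i)
| YH_torsion (i : 'I_n) : yh_rel (t i ^+ d) 1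
| YH_gt_lo (i : 'I_n.-1) : yh_rel (g i * t (ord_lo i)) (t (ord_hi i) * g i)
| YH_gt_hi (i : 'I_n.-1) : yh_rel (g i * t (ord_hi i)) (t (ord_lo i) * g i)
| YH_gt_far (i : 'I_n.-1) (j : 'I_n) of j != ord_lo i & j != ord_hi i :
    yh_rel (g i * t j) (t j * g i).

Definition yh_relators : set F := relators yh_rel.

(* With the indices shifted by one, the added relation is g_(1,2) = 0. *)
Inductive ytl_rel : F -> F -> Prop :=
| YTL_YH x y of yh_rel x y : ytl_rel x y
| YTL_g12 (i j : 'I_n.-1) of i = 0%N :> nat & j = 1%N :> nat :
    ytl_rel (gg_elt g i j) 0.

Definition ytl_relators : set F := relators ytl_rel.

(* Properness, by means of the character t_j |-> 1, g_i |-> -1. *)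
Definition sgn_char : F -> K^o :=
  free_eval (fun x : yh_gen => if x is inl _ then -1 else 1).

Lemma sgn_g i : sgn_char (g i) = -1. Proof. exact: free_eval_gen. Qed.
Lemma sgn_t i : sgn_char (t i) = 1. Proof. exact: free_eval_gen. Qed.

Lemma sgn_charB : zmod_morphism sgn_char. Proof. exact: free_evalB. Qed.
Lemma sgn_charM : monoid_morphism sgn_char. Proof. exact: free_evalM. Qed.

HB.instance Definition _ := GRing.LRMorphism.on sgn_char.

Let sD x y : sgn_char (x + y) = sgn_char x + sgn_char y.
Proof. exact: raddfD. Qed.
Let sM x y : sgn_char (x * y) = sgn_char x * sgn_char y.
Proof. exact: rmorphM. Qed.
Let s1 : sgn_char 1 = 1. Proof. exact: rmorph1. Qed.
Let sX x k : sgn_char (x ^+ k) = sgn_char x ^+ k. Proof. exact: rmorphXn. Qed.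
Let sZ a x : sgn_char (a *: x) = a * sgn_char x. Proof. exact: linearZ. Qed.

Lemma sgn_gg i j : sgn_char (gg_elt g i j) = 0.
Proof. by rewrite /gg_elt !sD s1 !sM !sgn_g; ring. Qed.

Lemma sgn_yh x y : yh_rel x y -> sgn_char x = sgn_char y.
Proof.
case=> [i j _|i j _|i|i j|i|i|i|i j _ _].
- by rewrite !sM mulrC.
- by rewrite !sM !sgn_g.
- by move: (e i) => z; rewrite sX !sD s1 !sZ !sM sgn_g; ring.
- by rewrite !sM mulrC.
- by rewrite s1 sX sgn_t expr1n.
- by rewrite !sM sgn_g !sgn_t mulrC.
- by rewrite !sM sgn_g !sgn_t mulrC.
- by rewrite !sM mulrC.
Qed.

Lemma sgn_ytl x y : ytl_rel x y -> sgn_char x = sgn_char y.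
Proof. by case=> [{}x {}y /sgn_yh//|i j _ _]; rewrite sgn_gg raddf0. Qed.

Lemma sgn_relators (R : F -> F -> Prop) :
  (forall x y, R x y -> sgn_char x = sgn_char y) ->
  forall z, relators R z -> sgn_char z = 0.
Proof. by move=> sR _ [x [y [/sR xy ->]]]; rewrite raddfB /= xy subrr. Qed.

Lemma yh_proper : ~ ideal_gen yh_relators 1.
Proof. exact/(proper_of_morphism sgn_charB sgn_charM)/sgn_relators/sgn_yh. Qed.
Lemma ytl_rel_proper : ~ ideal_gen ytl_relators 1.
Proof. exact/(proper_of_morphism sgn_charB sgn_charM)/sgn_relators/sgn_ytl. Qed.

HB.instance Definition _ := isProper.Build K F yh_relators yh_proper.
HB.instance Definition _ := isProper.Build K F ytl_relators ytl_rel_proper.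

Definition YH : algType K := alg_quot yh_relators.
Definition YH_g (i : 'I_n.-1) : YH := alg_pi yh_relators (g i).
Definition YH_t (j : 'I_n) : YH := alg_pi yh_relators (t j).

Definition ytl_gens : set YH :=
  [set x | exists i j : 'I_n.-1, `|i - j|%N = 1%N /\ x = gg_elt YH_g i j].

Lemma ytl_gens_proper : ~ ideal_gen ytl_gens 1.
Proof.
have sS := sgn_relators sgn_yh.
have fB := @alg_liftB K F K^o sgn_char yh_relators sS.
have fM := @alg_liftM K F K^o sgn_char yh_relators sS.
apply: (@proper_of_morphism K YH K^o _ fB fM) => _ [i [j [_ ->]]].
have -> : gg_elt YH_g i j = alg_pi yh_relators (gg_elt g i j).
  by rewrite /gg_elt !alg_piD !alg_piM alg_pi1.
by rewrite alg_lift_pi //= sgn_gg.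
Qed.

HB.instance Definition _ := isProper.Build K YH ytl_gens ytl_gens_proper.

Definition YTL : algType K := alg_quot ytl_gens.
Definition YTL_g (i : 'I_n.-1) : YTL := alg_pi ytl_gens (YH_g i).
Definition YTL_t (j : 'I_n) : YTL := alg_pi ytl_gens (YH_t j).

Definition YTL_pres : algType K := alg_quot ytl_relators.
Definition YTL_pres_g (i : 'I_n.-1) : YTL_pres := alg_pi ytl_relators (g i).
Definition YTL_pres_t (j : 'I_n) : YTL_pres := alg_pi ytl_relators (t j).

End YokonumaHecke.

(* As R : realType is a model of the real numbers, R[i] is C and this is C(u). *)
Definition Cu (R : realType) : fieldType := {fraction {poly R[i]}}.
Definition Cu_u (R : realType) : Cu R := tofrac 'X.

(* Main.v *)
Require Import Defs.
From HB Require Import structures.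
From mathcomp Require Import all_boot all_algebra.
From mathcomp Require Import classical_sets.
From mathcomp Require Import reals complex.

Import GRing.Theory Num.Theory.

Local Open Scope ring_scope.

(** The braid relations make all the elements
    [g_(i,i+1) = 1 + g_i + g_(i+1) + g_i g_(i+1) + g_(i+1) g_i
                 + g_i g_(i+1) g_i]
    conjugate to one another, so that killing the first one kills them all.
    Put [w = g_i g_(i+1) g_(i+2)].  Sliding [g_i] and [g_(i+1)] through [w] with
    the braid relations gives [w g_i = g_(i+1) w] and
    [w g_(i+1) = g_(i+2) w], hence [w g_(i,i+1) = g_(i+1,i+2) w]; if the left
    side vanishes and [w] has a right inverse, then [g_(i+1,i+2) = 0]
    ([braid_sum_shift]).  Moreover [g_(i+1,i) = g_(i,i+1)] by the braid relation
    alone ([braid_sum_sym]).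

    It remains to invert the generators [g_i].  The quadratic relation does so
    as soon as [u] is invertible and [e_i] is an idempotent that commutes with
    [g_i] ([quadratic_right_inverse]).  Both properties of [e_i] come from
    reading it as the average of the powers of [z = t_i t_(i+1)^(d-1)], which
    satisfies [z^d = 1] and is inverted by conjugation by [g_i]
    ([e_elt_idem], [e_elt_comm]); dividing by [d] is possible in
    characteristic 0.

    Hence every generator of the ideal defining the quotient of the
    Yokonuma--Hecke algebra vanishes in the algebra with the single additional
    relation ([pres_gg_adjacent]), and the universal properties of the two
    quotients yield mutually inverse morphisms ([YTL_pres_iso]). *)

Set Implicit Arguments.
Unset Strict Implicit.

(** * Averages over the powers of a root of unity *)

Section PowerSum.
Variables (A : nzRingType) (d : nat) (z : A).
Hypothesis zd : z ^+ d = 1.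

Lemma mul_sum_expr : z * (\sum_(s < d) z ^+ s) = \sum_(s < d) z ^+ s.
Proof.
rewrite mulr_sumr; under eq_bigr do rewrite -exprS.
apply: (addrI (z ^+ 0)); rewrite -(big_ord_recl d (fun s => z ^+ s)).
by rewrite big_ord_recr /= zd addrC expr0.
Qed.

Lemma sum_expr_sqr :
  (\sum_(s < d) z ^+ s) * (\sum_(s < d) z ^+ s) = (\sum_(s < d) z ^+ s) *+ d.
Proof.
rewrite mulr_suml; set S := \sum_(s < d) z ^+ s.
have E s : z ^+ s * S = S.
  by elim: s => [|s IH]; rewrite ?mul1r // exprSr -mulrA mul_sum_expr.
by under eq_bigr do rewrite E; rewrite sumr_const card_ord.
Qed.

(** Moving [g] to the right turns the powers of [z] into those of its inverse
    [w], which are the same elements in the reverse order. *)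
Lemma comm_sum_expr_inv (g w : A) :
  g * z = w * g -> w * z = 1 -> z * w = 1 ->
  g * (\sum_(s < d) z ^+ s) = (\sum_(s < d) z ^+ s) * g.
Proof.
move=> gz wz zw; set S := \sum_(s < d) z ^+ s.
have gzs s : g * z ^+ s = w ^+ s * g.
  elim: s => [|s IH]; first by rewrite !expr0 mulr1 mul1r.
  by rewrite exprSr mulrA IH -mulrA gz mulrA -exprSr.
have wzs s : z ^+ s * w ^+ s = 1.
  elim: s => [|s IH]; first by rewrite !expr0 mulr1.
  by rewrite exprSr exprS -mulrA (mulrA z) zw mul1r.
rewrite {1}/S mulr_sumr; under eq_bigr do rewrite gzs.
rewrite -mulr_suml; congr (_ * _).
have -> : S = \sum_(s < d) z ^+ s.+1.
  by rewrite -[S]mul_sum_expr mulr_sumr; under eq_bigr do rewrite -exprS.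
rewrite (reindex_inj rev_ord_inj) /=; apply: eq_bigr => s _.
rewrite -[LHS]mul1r -[in LHS]zd -{1}(subnK (ltn_ord s)) addnC exprD -mulrA wzs.
by rewrite mulr1.
Qed.

End PowerSum.

(** * Inverting the quadratic relation *)

Section Quadratic.
Variables (K : fieldType) (A : algType K) (u : K).

(** On [1 - e] the element [g] is an involution, and on [e] it satisfies
    [g^2 = u + (u - 1) g]; glueing the inverses of the two parts gives
    [g^-1 = g + (u^-1 - 1) (e + e g)]. *)
Lemma quadratic_right_inverse (g e : A) :
  u != 0 -> e * e = e -> g * e = e * g ->
  g ^+ 2 = 1 + (u - 1) *: e + (u - 1) *: (e * g) ->
  exists h, g * h = 1.
Proof.
move=> u0 ee ge g2; exists (g + (u^-1 - 1) *: (e + e * g)).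
have D (a b : K) (v : A) : a *: v + b *: v = (a + b) *: v by rewrite scalerDl.
have eg2 : e * (g * g) = u *: e + (u - 1) *: (e * g).
  rewrite -expr2 g2 !mulrDr mulr1 -!scalerAr mulrA ee; congr (_ + _).
  by rewrite -{1}[e]scale1r D addrC subrK.
have geg : e * g + (u *: e + (u - 1) *: (e * g)) = u *: (e + e * g).
  by rewrite scalerDr addrCA -{1}[e * g]scale1r D (addrC 1) subrK.
have c : (u^-1 - 1) * u = - (u - 1) by rewrite mulrBl mulVf // mul1r opprB.
rewrite mulrDr -scalerAr mulrDr (mulrA g) ge -mulrA eg2 geg scalerA c scaleNr.
by rewrite -expr2 g2 -[1 + _ + _]addrA -scalerDr addrK.
Qed.

End Quadratic.

(** * Transport of the Temperley--Lieb elements by braids *)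

Section Braid.
Variable A : nzRingType.

(** The sum over the elements of the symmetric group generated by two adjacent
    transpositions; [gg_elt g i j] is [braid_sum (g i) (g j)] by definition. *)
Definition braid_sum (a b : A) := 1 + a + b + a * b + b * a + a * b * a.

Lemma braid_sum_sym a b : b * a * b = a * b * a -> braid_sum b a = braid_sum a b.
Proof.
move=> ab; rewrite /braid_sum ab -!addrA; congr (_ + _).
by rewrite addrCA; congr (_ + (_ + _)); rewrite addrCA.
Qed.

Lemma braid_sum_transport (w a b a' b' : A) :
  w * a = a' * w -> w * b = b' * w ->
  w * braid_sum a b = braid_sum a' b' * w.
Proof.
move=> wa wb; have P x y x' y' : w * x = x' * w -> w * y = y' * w ->
    w * (x * y) = x' * y' * w.
  by move=> wx wy; rewrite mulrA wx -mulrA wy mulrA.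
rewrite /braid_sum !mulrDr !mulrDl mulr1 mul1r wa wb.
by rewrite (P _ _ _ _ wa wb) (P _ _ _ _ wb wa) (P _ _ _ _ (P _ _ _ _ wa wb) wa).
Qed.

(** The braid [a b c] carries the pair [(a, b)] to [(b, c)]. *)
Lemma braid_sum_shift (a b c : A) :
  b * a * b = a * b * a -> c * b * c = b * c * b -> a * c = c * a ->
  (exists h, a * h = 1) -> (exists h, b * h = 1) -> (exists h, c * h = 1) ->
  braid_sum a b = 0 -> braid_sum b c = 0.
Proof.
move=> bab cbc ac [a' aK] [b' bK] [c' cK] ab0; pose w := a * b * c.
have wa : w * a = b * w by rewrite /w -mulrA -ac mulrA -bab !mulrA.
have wb : w * b = c * w by rewrite /w -!mulrA (mulrA b) -cbc !mulrA ac.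
have wK : w * (c' * b' * a') = 1.
  by rewrite /w -!mulrA (mulrA c) cK mul1r (mulrA b) bK mul1r.
rewrite -[LHS]mulr1 -wK mulrA.
by rewrite -(braid_sum_transport wa wb) ab0 mulr0 mul0r.
Qed.

End Braid.

(** * Morphisms out of quotient algebras *)

Section Quotients.
Variables (K : comNzRingType) (A : algType K).

Lemma alg_lift_lrmorphism (B : algType K) (S : properSet A)
    (f : {lrmorphism A -> B}) :
  (forall x, (S : set A) x -> f x = 0) ->
  exists phi : {lrmorphism alg_quot S -> B}, forall x, phi (alg_pi S x) = f x.
Proof.
move=> fS; have piE := @alg_lift_pi K A B f S fS.
have Z : scalable (@alg_lift K A B f S).
  by move=> k x; rewrite -[x]alg_reprK -linearZ !piE linearZ.
pose m1 := GRing.isZmodMorphism.Build _ _ _ (@alg_liftB K A B f S fS).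
pose m2 := GRing.isMonoidMorphism.Build _ _ _ (@alg_liftM K A B f S fS).
pose m3 := GRing.isScalable.Build K _ _ *:%R _ Z.
pose phi : {lrmorphism alg_quot S -> B} := HB.pack (@alg_lift K A B f S) m1 m2 m3.
by exists phi.
Qed.

Lemma alg_pi_eq0 (S : set A) x : S x -> alg_pi S x = 0.
Proof.
move=> Sx; have -> : 0 = alg_pi S 0 by rewrite /alg_pi raddf0.
by apply/alg_piP; rewrite subr0 => I [_]; apply.
Qed.

Lemma alg_pi_relator (Q : A -> A -> Prop) x y :
  Q x y -> alg_pi (relators Q) x = alg_pi (relators Q) y.
Proof.
move=> Qxy; apply/eqP; rewrite -subr_eq0 -alg_pi_sub.
by apply/eqP/alg_pi_eq0; exists x, y.
Qed.

End Quotients.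

Section Images.
Variables (K : fieldType) (d n : nat) (A B : algType K) (f : {lrmorphism A -> B}).

Lemma lrmorph_e_elt (t : 'I_n -> A) i :
  f (e_elt d t i) = e_elt d (f \o t) i.
Proof.
rewrite /e_elt linearZ raddf_sum /=; congr (_ *: _); apply: eq_bigr => s _.
by rewrite (rmorphM f) !(rmorphXn f).
Qed.

Lemma lrmorph_gg_elt (g : 'I_n.-1 -> A) i j :
  f (gg_elt g i j) = gg_elt (f \o g) i j.
Proof. by rewrite /gg_elt !(raddfD f) /= !(rmorphM f) (rmorph1 f). Qed.

End Images.

(** * The idempotents of the Yokonuma--Hecke algebra *)

Section Idempotents.
Variables (K : fieldType) (d n : nat) (A : algType K).
Variables (t : 'I_n -> A) (i : 'I_n.-1).
Hypotheses (d_gt0 : (0 < d)%N) (dK : d%:R != 0 :> K).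
Hypothesis tt : t (ord_lo i) * t (ord_hi i) = t (ord_hi i) * t (ord_lo i).
Hypotheses (lo_d : t (ord_lo i) ^+ d = 1) (hi_d : t (ord_hi i) ^+ d = 1).

Local Notation x := (t (ord_lo i)).
Local Notation y := (t (ord_hi i)).
Local Notation z := (x * y ^+ d.-1).

Let xX k m : GRing.comm (x ^+ m) (y ^+ k).
Proof. exact/commrX/commr_sym/commrX. Qed.

Let hi_inv : y * y ^+ d.-1 = 1. Proof. by rewrite -exprS prednK. Qed.
Let lo_inv : x * x ^+ d.-1 = 1. Proof. by rewrite -exprS prednK. Qed.

Let z_unity : z ^+ d = 1.
Proof.
by rewrite exprMn_comm; [rewrite lo_d mul1r exprAC hi_d expr1n | exact: (xX _ 1)].
Qed.

(** Since [y^d = 1], the inverse of [y] is [y^(d-1)], and [y^(d-s)] is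
    its [s]-th power. *)
Lemma e_elt_geom : e_elt d t i = d%:R^-1 *: \sum_(s < d) z ^+ s.
Proof.
rewrite /e_elt; congr (_ *: _); apply: eq_bigr => s _.
rewrite exprMn_comm; last exact: (xX _ 1).
congr (_ * _); rewrite -exprM.
have Y : y ^+ s * y ^+ (d - s) = 1 by rewrite -exprD subnKC // ltnW.
have Y' : y ^+ (d.-1 * s) * y ^+ s = 1.
  by rewrite -exprD -mulSnr prednK // exprM hi_d expr1n.
by rewrite -[LHS]mul1r -Y' -mulrA Y mulr1.
Qed.

Lemma e_elt_idem : e_elt d t i * e_elt d t i = e_elt d t i.
Proof.
rewrite e_elt_geom -scalerAl -scalerAr sum_expr_sqr // -[X in _ *: (_ *: X)]scaler_nat.
by rewrite (scalerA _ d%:R) mulVf // scale1r.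
Qed.

Lemma e_elt_comm g : g * x = y * g -> g * y = x * g ->
  g * e_elt d t i = e_elt d t i * g.
Proof.
move=> gx gy; rewrite e_elt_geom -scalerAr -scalerAl; congr (_ *: _).
apply: (comm_sum_expr_inv z_unity (w := y * x ^+ d.-1)).
- rewrite mulrA gx -!mulrA; congr (_ * _).
  elim: d.-1 => [|k IH]; first by rewrite !expr0 mulr1 mul1r.
  by rewrite exprSr mulrA IH -mulrA gy mulrA -exprSr.
- rewrite mulrA -(mulrA y) -exprSr prednK // lo_d mulr1; exact: hi_inv.
- rewrite mulrA -(mulrA x) -exprSr prednK // hi_d mulr1; exact: lo_inv.
Qed.

End Idempotents.

(** * Consequences of the single relation *)

Section Presentation.
Variables (K : fieldType) (u : K) (d n : nat).
Hypotheses (u0 : u != 0) (d_gt0 : (0 < d)%N) (dK : d%:R != 0 :> K).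

Local Notation pi := (@alg_pi K _ (@ytl_relators K u d n)).
Local Notation g := (@YTL_pres_g K u d n).
Local Notation t := (@YTL_pres_t K u d n).

Let yhE x y (xy : yh_rel u d x y) : pi x = pi y.
Proof. exact/alg_pi_relator/YTL_YH. Qed.

Lemma pres_g_right_inverse i : exists h, g i * h = 1.
Proof.
have tt : t (ord_lo i) * t (ord_hi i) = t (ord_hi i) * t (ord_lo i).
  by rewrite /YTL_pres_t -!rmorphM; apply/yhE/YH_tt.
have td j : t j ^+ d = 1.
  by rewrite /YTL_pres_t -rmorphXn -(rmorph1 pi); apply/yhE/YH_torsion.
apply: (quadratic_right_inverse (u := u) (e := e_elt d t i)) => //.
- exact: e_elt_idem.
- by apply: e_elt_comm => //; rewrite /YTL_pres_t /YTL_pres_g -!rmorphM;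
    apply: yhE; constructor.
- rewrite /YTL_pres_g -rmorphXn /= (yhE (YH_quad _ _ _)).
  have -> : e_elt d t i = pi (e_elt d (@free_t K n) i).
    exact/esym/(lrmorph_e_elt _ pi).
  (* Being itself a scaled sum, [e] would otherwise be expanded by [linearZ]. *)
  move: (e_elt d (@free_t K n) i) => e.
  by rewrite !raddfD /= rmorph1 !linearZ /= rmorphM.
Qed.

Lemma pres_braid (i j : 'I_n.-1) : j = i.+1 :> nat ->
  g j * g i * g j = g i * g j * g i.
Proof. by move=> ij; rewrite /YTL_pres_g -!rmorphM; apply/yhE/YH_braid. Qed.

Lemma pres_far (i j : 'I_n.-1) : (`|i - j| > 1)%N -> g i * g j = g j * g i.
Proof. by move=> ij; rewrite /YTL_pres_g -!rmorphM; apply/yhE/YH_gg_far. Qed.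

(** By induction along the braid: the relation added to the presentation starts
    it, and [braid_sum_shift] moves it one strand further. *)
Lemma pres_gg_succ (i j : 'I_n.-1) : j = i.+1 :> nat -> gg_elt g i j = 0.
Proof.
case: i j => [k]; elim: k => [|k IH] hi [j hj] /= ij; subst j.
  rewrite -(lrmorph_gg_elt pi) -(raddf0 pi).
  by apply/alg_pi_relator/YTL_g12.
have hi' := ltnW hi.
apply: (braid_sum_shift (a := g (Ordinal hi')) (b := g (Ordinal hi))
  (c := g (Ordinal hj))).
- exact: pres_braid.
- exact: pres_braid.
- by apply: pres_far => /=; rewrite -(addn2 k) distnEr ?leq_addr // addKn.
- exact: pres_g_right_inverse.
- exact: pres_g_right_inverse.
- exact: pres_g_right_inverse.
- exact: IH.
Qed.

Lemma pres_gg_adjacent (i j : 'I_n.-1) : `|i - j|%N = 1%N -> gg_elt g i j = 0.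
Proof.
have [ij|ji] := leqP i j => dij.
  apply: pres_gg_succ; move: dij; rewrite distnEr // => dij.
  by rewrite -(subnK ij) dij.
have ij : i = j.+1 :> nat.
  by move: dij; rewrite distnEl 1?ltnW // => dij; rewrite -(subnK (ltnW ji)) dij.
by rewrite -(pres_gg_succ ij); apply: braid_sum_sym; rewrite pres_braid.
Qed.

End Presentation.

(** * The isomorphism *)

Section Isomorphism.
Variables (K : fieldType) (u : K) (d n : nat).
Hypotheses (u0 : u != 0) (d_gt0 : (0 < d)%N) (dK : d%:R != 0 :> K).

(** Both algebras are quotients of the free algebra, so morphisms that are
    compatible with the projections are inverse to each other.  The one towards
    [YTL] exists because the added relator is among the generators of the ideal;
    the one from [YTL] descends in two steps, first to [YH] and then along the
    ideal, by [pres_gg_adjacent]. *)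
Theorem YTL_pres_iso :
  exists phi : {lrmorphism YTL_pres u d n -> YTL u d n},
    [/\ bijective phi,
        forall i, phi (YTL_pres_g u d i) = YTL_g u d i
      & forall j, phi (YTL_pres_t u d j) = YTL_t u d j].
Proof.
pose piY := @alg_pi K _ (@yh_relators K u d n).
pose piI := @alg_pi K _ (@ytl_gens K u d n).
pose piP := @alg_pi K _ (@ytl_relators K u d n).
have [|phi phiE] := @alg_lift_lrmorphism _ _ _
  (@ytl_relators K u d n) (piI \o piY).
  move=> _ [_ [_ [[x y xy|i j i0 j1] ->]]] /=.
    by rewrite raddfB /= /piY (alg_pi_relator xy) subrr raddf0.
  rewrite subr0 /piY lrmorph_gg_elt; apply: alg_pi_eq0.
  by exists i, j; rewrite i0 j1.
have [|chi chiE] := @alg_lift_lrmorphism _ _ _ (@yh_relators K u d n) piP.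
  move=> _ [x [y [xy ->]]]; rewrite raddfB /= /piP.
  by rewrite (alg_pi_relator (YTL_YH xy)) subrr.
have [|psi psiE] := @alg_lift_lrmorphism _ _ _ (@ytl_gens K u d n) chi.
  move=> _ [i [j [ij ->]]]; rewrite lrmorph_gg_elt.
  rewrite -[RHS](pres_gg_adjacent u0 d_gt0 dK ij).
  by rewrite /gg_elt /= /YH_g !chiE.
exists phi; split=> [|i|j]; last 2 first.
- exact: phiE.
- exact: phiE.
exists psi => x.
  by rewrite -[x]alg_reprK phiE /= psiE chiE.
by rewrite -[x]alg_reprK psiE -[alg_repr x]alg_reprK chiE phiE.
Qed.

End Isomorphism.

Unset Implicit Arguments.

Theorem corollary1 (R : realType) (d n : nat) (hd : (1 <= d)%N) (hn : (3 <= n)%N) :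
  exists phi : {lrmorphism YTL_pres (Cu_u R) d n -> YTL (Cu_u R) d n},
    [/\ bijective phi,
        forall i : 'I_n.-1, phi (YTL_pres_g (Cu_u R) d i) = YTL_g (Cu_u R) d i
      & forall j : 'I_n, phi (YTL_pres_t (Cu_u R) d j) = YTL_t (Cu_u R) d j].
Proof.
apply: YTL_pres_iso => //.
- by rewrite /Cu_u tofrac_eq0 polyX_eq0.
- by rewrite -tofrac1 -tofracMn tofrac_eq0 -polyC1 -polyCMn polyC_eq0 pnatr_eq0 -lt0n.
Qed.
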